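(* Let $(X,d)$ be a metric space, $x_0\in X$ a point, and $\mathcal{H}_\infty(X)$ the set of all unbounded subsets of $X$. Define a relation $\delta$ on the power set of $\mathcal{H}_\infty(X)$ as follows: $\mathcal{A}\,\delta\,\mathcal{C}$ if and only if for every adequate sequence $f$ there are an $A\in\mathcal{A}$ and a $C\in\mathcal{C}$ such that $A\ll U_{x_0}(C,f)$ and $C\ll U_{x_0}(A,f)$. Then $\delta$ is a proximity on $\mathcal{H}_\infty(X)$.
   Context: Here $\mathbb{N}=\{1,2,\dots\}$. For subsets $A,B$ of a metric space $(X,d)$ put $d(A,B)=\inf\{d(x,y)\mid x\in A, y\in B\}$, with $\inf\emptyset=\infty$. Write $A\,\mathbf{b}\,B$ if there exists $\epsilon<\infty$ such that for all bounded sets $D\subseteq X$, $d(A\setminus D,B\setminus D)<\epsilon$; $\bar{\mathbf{b}}$ denotes the negation of $\mathbf{b}$. Write $A\ll B$ ($B$ is a coarse neighborhood of $A$) if $A\,\bar{\mathbf{b}}\,(X\setminus B)$. A sequence $f:\mathbb{N}\to\mathbb{R}$ is adequate if it is positive and $f(n)-f(n-1)>n+1$ for all $n>1$. For $A\subseteq X$, $x_0\in X$ and an adequate sequence $f$, put $A_0^f=A$, $A_n^f=\mathscr{B}(A,n)\setminus\mathscr{B}(x_0,f(n))$ for $n\geq 1$, and $U_{x_0}(A,f)=\bigcup_{n\geq 0}A_n^f$, where $\mathscr{B}(x,r)$ is the open ball and $\mathscr{B}(A,r)=\bigcup_{x\in A}\mathscr{B}(x,r)$. A proximity on a set $Z$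 is a relation $\delta$ on the power set of $Z$ such that for all $A,B,C\subseteq Z$ (with $\bar\delta$ the negation of $\delta$): (i) $A\delta B$ implies $B\delta A$; (ii) $(A\cup B)\delta C$ iff $A\delta C$ or $B\delta C$; (iii) $A\delta B$ implies $A\neq\emptyset$ and $B\neq\emptyset$; (iv) $A\bar\delta B$ implies that there exists a subset $E\subseteq Z$ such that $A\bar\delta E$ and $(Z\setminus E)\bar\delta B$; (v) $A\cap B\neq\emptyset$ implies $A\delta B$. *)

(* Defs.v *)
From mathcomp Require Import all_boot all_order all_algebra.
From mathcomp Require Import all_classical all_reals all_analysis.

Set Implicit Arguments.
Unset Strict Implicit.
Unset Printing Implicit Defensive.

Import Order.TTheory GRing.Theory Num.Theory.

Local Open Scope classical_set_scope.
Local Open Scope ring_scope.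

Record is_proximity (Z : Type) (delta : set Z -> set Z -> Prop) : Prop := {
  proximity_sym : forall A B, delta A B -> delta B A ;
  proximityU : forall A B C, delta (A `|` B) C <-> delta A C \/ delta B C ;
  proximity_neq0 : forall A B, delta A B -> A !=set0 /\ B !=set0 ;
  proximity_strong : forall A B, ~ delta A B ->
    exists E : set Z, ~ delta A E /\ ~ delta (~` E) B ;
  proximityI : forall A B, A `&` B !=set0 -> delta A B }.

Section CoarseProximity.
Context {R : realType} {X : metricType R}.
Implicit Types (A B D : set X) (f : nat -> R).

(* The library's [bounded_set] is only available in normed spaces. *)
Definition mbounded A : Prop :=
  exists M : R, forall x y, A x -> A y -> mdist x y <= M.

(* Extended-real valued: the infimum of the empty set is +oo. *)
Definition set_dist A B : \bar R :=
  ereal_inf [set (mdist x y)%:E | x in A & y in B].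

Definition coarsely_close A B : Prop :=
  exists eps : R, forall D, mbounded D ->
    (set_dist (A `\` D) (B `\` D) < eps%:E)%E.

Definition coarse_nbhd A B : Prop := ~ coarsely_close A (~` B).

Definition set_ball A (r : R) : set X := \bigcup_(x in A) ball x r.

(* Sequences are indexed by the positive integers, so [f 0] is left
   unconstrained; it is not used in [Uset] either. *)
Definition adequate f : Prop :=
  (forall n, (0 < n)%N -> 0 < f n) /\
  (forall n, (1 < n)%N -> f n - f n.-1 > n.+1%:R).

Definition Uset_layer (x0 : X) A f (n : nat) : set X :=
  if n is 0%N then A else set_ball A n%:R `\` ball x0 (f n).

Definition Uset (x0 : X) A f : set X := \bigcup_n Uset_layer x0 A f n.

End CoarseProximity.

Definition Hinf {R : realType} (X : metricType R) : set (set X) :=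
  [set A | ~ mbounded A].

Arguments Hinf {R} X.

(* [Hinf X] is coerced to the subtype of its elements; [\val] is the injection
   of this subtype into [set X]. *)
Definition Hdelta {R : realType} {X : metricType R} (x0 : X)
    (AA CC : set (Hinf X)) : Prop :=
  forall f : nat -> R, adequate f ->
    exists A C : Hinf X,
      [/\ AA A, CC C,
          coarse_nbhd (\val A) (Uset x0 (\val C) f) &
          coarse_nbhd (\val C) (Uset x0 (\val A) f)].

(* Main.v *)
Require Import Defs.
From mathcomp Require Import all_boot all_order all_algebra.
From mathcomp Require Import all_classical all_reals all_analysis.
From mathcomp Require Import zify lra.

(** Far away from [x0], [A << B] says that every [eps]-neighbour of [A] lies in
    [B], so [B] only matters up to a bounded set.  Since [Uset C f] shrinks when
    [f] grows, the union axiom follows by taking the maximum of two sequences.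
    For the strong axiom, [g n := f (2n) + n] satisfies
    [Uset (Uset C g) g `<=` Uset C f]; together with the fact that [Uset _ g]
    changes only by a bounded set when its argument does, this makes the
    relation [A << Uset C _] transitive up to replacing [g] by [f].  One
    separates [AA] from [CC] by the set of all [S] such that [S << Uset C g]
    and [C << Uset S g] for some [C] in [CC]. *)

Set Implicit Arguments.
Unset Strict Implicit.
Unset Printing Implicit Defensive.

Import Order.TTheory GRing.Theory Num.Theory.

Local Open Scope classical_set_scope.
Local Open Scope ring_scope.

Section AdequateSequences.
Context {R : realType}.
Implicit Types f g : nat -> R.

(** Without some adequate sequence [Hdelta] would hold vacuously, even for empty families; the
    nonemptiness axiom rests on this one. *)
Lemma adequate_sqr : adequate (fun n => n.+1%:R ^+ 2 : R).
Proof.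
split=> [n _|[|n] // n_gt0]; first by rewrite exprn_gt0 ?ltr0n.
have : 1 <= n%:R :> R by rewrite ler1n.
rewrite /= -!natr1; lra.
Qed.

Lemma adequate_max f g : adequate f -> adequate g ->
  adequate (fun n => Num.max (f n) (g n)).
Proof.
move=> [f0 fS] [g0 gS]; split=> n n1 /=; first by rewrite lt_max f0.
rewrite ltrBrDr lt_max -!ltrBrDr.
(* The sequence attaining the maximum at [n.-1] alone gains the required increment. *)
by case: (leP (f n.-1)) => _; rewrite ?fS ?gS ?orbT.
Qed.

Lemma adequate_double f : adequate f -> adequate (fun n => f n.*2 + n%:R).
Proof.
move=> [f0 fS]; split=> [n n0|[|n] // n_gt0].
  by rewrite ltr_pwDl ?ler0n// f0 ?double_gt0.
have := fS n.*2.+2 isT.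
have := fS n.*2.+1; rewrite ltnS double_gt0 => /(_ n_gt0).
rewrite doubleS /= -!natr1 -muln2 natrM.
have := ler0n R n; lra.
Qed.

Lemma adequate_homo f m n : adequate f -> (0 < m <= n)%N -> f m <= f n.
Proof.
move=> [_ fS] /andP[m0]; elim: n => [|n IHn]; first by rewrite leqNgt m0.
rewrite leq_eqVlt => /predU1P[->//|]; rewrite ltnS => mn.
have := IHn mn; have := fS n.+1; rewrite ltnS => /(_ (leq_trans m0 mn)).
rewrite /=; have := ler0n R n.+2; lra.
Qed.

Lemma adequate_gt f n : adequate f -> (0 < n)%N -> 2 * n%:R - 2 < f n.
Proof.
move=> [f0 fS]; elim: n => // -[_ _|n IHn _]; first by have := f0 1%N isT; lra.
have := IHn isT; have := fS n.+2 isT.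
rewrite /= -!natr1; have := ler0n R n; lra.
Qed.

End AdequateSequences.

Section CoarseNeighborhoods.
Context {R : realType} {X : metricType R}.
Variable x0 : X.
Implicit Types (A B C D : set X) (f g : nat -> R).

Lemma mboundedP D :
  mbounded D <-> exists r, forall x, D x -> mdist x0 x < r.
Proof.
split=> [[M DM]|[r Dr]]; last first.
  exists (r + r) => x y /Dr x_r /Dr y_r.
  have := @metric_triangle _ X x x0 y; rewrite (metric_sym x x0); lra.
have [->|/set0P[a Da]] := eqVneq D set0; first by exists 0.
exists (mdist x0 a + M + 1) => x Dx.
have := DM _ _ Da Dx; have := @metric_triangle _ X x0 a x; lra.
Qed.

(** Every bounded set lies in a ball around [x0], so removing such balls is enough, and an infimum
    below [eps] is witnessed by a pair of points. *)
Lemma coarse_nbhdP A B : coarse_nbhd A B <->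
  forall eps, exists r, forall x y, A x -> r <= mdist x0 x ->
    r <= mdist x0 y -> mdist x y < eps -> B y.
Proof.
split=> [AB eps|AB [eps close]].
  apply: contrapT => nr; apply: AB; exists eps => D /mboundedP[r Dr].
  rewrite ltNge; apply/negP => eps_le; apply: nr; exists r => x y Ax rx ry xy.
  apply: contrapT => nBy; move: xy; apply/negP; rewrite -leNgt -lee_fin.
  apply: le_trans eps_le _; apply: ereal_inf_lbound; exists x.
    by split=> // /Dr; rewrite ltNge rx.
  by exists y => //; split=> // /Dr; rewrite ltNge ry.
have [r ABr] := AB eps.
have Dr : mbounded [set x | mdist x0 x < r] by apply/mboundedP; exists r.
have /ereal_inf_lt[_ [x [Ax /negP rx] [y [nBy /negP ry] <-]]] := close _ Dr.
by move: rx ry; rewrite -!leNgt lte_fin => rx ry /(ABr _ _ Ax rx ry).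
Qed.

Lemma coarse_nbhd_weaken A B B' : coarse_nbhd A B ->
    (exists s, forall y, s <= mdist x0 y -> B y -> B' y) ->
  coarse_nbhd A B'.
Proof.
move=> /coarse_nbhdP AB [s BB']; apply/coarse_nbhdP => eps.
have [r ABr] := AB eps; exists (Num.max r s) => x y Ax.
rewrite !ge_max => /andP[rx _] /andP[ry sy] xy.
exact: BB' (ABr _ _ Ax rx ry xy).
Qed.

Lemma UsetP A f y : Uset x0 A f y <-> A y \/
  exists n, [/\ (0 < n)%N, f n <= mdist x0 y &
                exists2 a, A a & mdist a y < n%:R].
Proof.
split=> [[[_ Ay|n _ [[a Aa]]]]|[Ay|[n [n0 fy [a Aa ay]]]]].
- by left.
- rewrite !ballEmdist /= => ay /negP; rewrite -leNgt => fy.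
  by right; exists n.+1; split=> //; exists a.
- by exists 0%N.
- case: n n0 fy ay => // n _ fy ay; exists n.+1 => //; split.
    by exists a; rewrite ?ballEmdist.
  by rewrite ballEmdist /=; apply/negP; rewrite -leNgt.
Qed.

Lemma sub_Uset A f g : (forall n, (0 < n)%N -> g n <= f n) ->
  Uset x0 A f `<=` Uset x0 A g.
Proof.
move=> gf y /UsetP[Ay|[n [n0 fy Ay]]]; apply/UsetP; first by left.
by right; exists n; split=> //; apply: le_trans (gf _ n0) fy.
Qed.

Lemma coarse_nbhd_Uset_le A C f g : (forall n, g n <= f n) ->
  coarse_nbhd A (Uset x0 C f) -> coarse_nbhd A (Uset x0 C g).
Proof.
by move=> gf /coarse_nbhd_weaken; apply; exists 0 => y _; apply: sub_Uset.
Qed.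

(** A single layer, of index [n > eps], already catches all [eps]-neighbours of [A] outside the ball
    of radius [f n]. *)
Lemma Uset_coarse_nbhd A f : coarse_nbhd A (Uset x0 A f).
Proof.
apply/coarse_nbhdP => eps; pose n := (Num.truncn eps).+1.
exists (f n) => x y Ax _ fy xy; apply/UsetP; right; exists n; split=> //.
by exists x => //; apply: lt_trans xy (truncnS_gt _).
Qed.

(* The layers of [Uset x0 S g] around a bounded part of [S] are empty for large
   indices, because [g n - n] tends to infinity. *)
Lemma Uset_mod_bounded S T g s : adequate g ->
    (forall x, s <= mdist x0 x -> S x -> T x) ->
  exists r, forall y, r <= mdist x0 y -> Uset x0 S g y -> Uset x0 T g y.
Proof.
move=> ag ST; exists (2 * `|s| + 2) => y ry.
have s_le := ler_norm s; have s_ge0 := normr_ge0 s.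
case/UsetP=> [Sy|[n [n0 gy [a Sa ay]]]]; apply/UsetP.
  by left; apply: ST => //; lra.
right; exists n; split=> //; exists a => //; apply: ST => //.
have := adequate_gt ag n0; have := @metric_triangle _ X x0 a y; lra.
Qed.

(** Jumps of [m] and then [n] make one of [m + n], at most twice the larger index; hence the
    doubling in [g]. *)
Lemma Uset_double A f : adequate f ->
  let g n := f n.*2 + n%:R in Uset x0 (Uset x0 A g) g `<=` Uset x0 A f.
Proof.
move=> af g.
have fg n : (0 < n)%N -> f n <= g n.
  move=> n0; rewrite /g -[leLHS]addr0 lerD ?ler0n//.
  by apply: adequate_homo; rewrite // n0 -addnn leq_addl.
move=> y /UsetP[/(sub_Uset fg)//|[n [n0 gy [u Uu uy]]]].
case/UsetP: Uu => [Au|[m [m0 gu [a Aa au]]]].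
  apply/UsetP; right; exists n; split=> //; last by exists u.
  exact: le_trans (fg _ n0) gy.
apply/UsetP; right; exists (m + n)%N; split; first by rewrite addn_gt0 m0.
  have [mn|nm] := leqP m n.
    have : f (m + n)%N <= f n.*2 by apply: adequate_homo => //; lia.
    by move: gy; rewrite /g; have := ler0n R n; lra.
  (* The distance bound now comes from [u]: passing to [y] loses less than [n], which the summand
     [m] of [g m] absorbs. *)
  have : f (m + n)%N <= f m.*2 by apply: adequate_homo => //; lia.
  have : n%:R <= m%:R :> R by rewrite ler_nat ltnW.
  move: gu uy; rewrite /g (metric_sym u).
  have := @metric_triangle _ X x0 y u; lra.
exists a => //; rewrite natrD.
have := @metric_triangle _ X a u y; lra.
Qed.

Lemma coarse_nbhd_Uset_trans A S C f : adequate f ->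
  let g n := f n.*2 + n%:R in
  coarse_nbhd A (Uset x0 S g) -> coarse_nbhd S (Uset x0 C g) ->
  coarse_nbhd A (Uset x0 C f).
Proof.
(* Any positive [eps] would do: with [y = x] it places [S] inside [Uset x0 C g] up to a bounded
   set. *)
move=> af g AS /coarse_nbhdP /(_ 1) [r SC].
have SUC x : r <= mdist x0 x -> S x -> Uset x0 C g x.
  by move=> rx Sx; apply: (SC x x); rewrite // mdistxx.
have [s sU] := Uset_mod_bounded (adequate_double af) SUC.
apply: coarse_nbhd_weaken AS _; exists s => y sy /(sU _ sy).
exact: Uset_double.
Qed.

End CoarseNeighborhoods.

Theorem theorem8p17 (R : realType) (X : metricType R) (x0 : X) :
  is_proximity (Hdelta x0).
Proof.
split.
- move=> AA CC AC f /AC[A [C [Aa Cc h1 h2]]].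
  by exists C, A; split.
- move=> AA BB CC; split; last first.
    by case=> AC f /AC[A [C [Aa Cc h1 h2]]];
      exists A, C; split=> //; [left|right].
  apply: contraPP => /not_orP[].
  move=> /existsNP[f /not_implyP[af nf]] /existsNP[g /not_implyP[ag ng]].
  move=> /(_ _ (adequate_max af ag)) [A [C [AB Cc h1 h2]]].
  have le_maxf n : f n <= Num.max (f n) (g n) by rewrite le_max lexx.
  have le_maxg n : g n <= Num.max (f n) (g n) by rewrite le_max lexx orbT.
  case: AB => Aa; [apply: nf|apply: ng]; exists A, C.
    split=> //; [exact: coarse_nbhd_Uset_le h1|exact: coarse_nbhd_Uset_le h2].
  split=> //; [exact: coarse_nbhd_Uset_le h1|exact: coarse_nbhd_Uset_le h2].
- move=> AA CC /(_ _ adequate_sqr) [A [C [Aa Cc _ _]]].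
  by split; [exists A|exists C].
- move=> AA CC /existsNP[f /not_implyP[af nf]].
  pose g n := f n.*2 + n%:R.
  have ag : adequate g := adequate_double af.
  exists [set S | exists C, [/\ CC C,
    coarse_nbhd (\val S) (Uset x0 (\val C) g) &
    coarse_nbhd (\val C) (Uset x0 (\val S) g)]].
  split=> [/(_ _ ag) [A [S [Aa [C [Cc SC CS]] AS SA]]]|].
    apply: nf; exists A, C; split=> //.
      exact: coarse_nbhd_Uset_trans AS SC.
    exact: coarse_nbhd_Uset_trans CS SA.
  (* Closeness tested on [g] yields an [S] outside the separating set that meets its defining
     condition. *)
  by move=> /(_ _ ag) [S [C [nS Cc SC CS]]]; apply: nS; exists C.
- move=> AA CC [A [Aa Ca]] f _.
  by exists A, A; split=> //; apply: Uset_coarse_nbhd.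
Qed.
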